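(* Let $(K,v)$ be a henselian valued field of arbitrary rank and let $w$ be an extension of $v$ to $K(X)$. Let $\{Q_i\}_{i\in\Delta}$ be a complete set of abstract key polynomials (ABKPs) for $w$, with $\Delta=\bigcup_{j\in I}\Delta_j$ and $\Delta_j=\{j\}\cup\vartheta_j$, having the properties (1)–(7) listed in the context, and assume that $\vartheta_j=\emptyset$ for every $j\in I$. If $I\neq\{0\}$, then there exists $n\in I\setminus\{0\}$ such that $Q_n$ has a saturated distinguished chain.
   Context: Let $\bar v$ be the extension of $v$ to a fixed algebraic closure $\overline K$ of $K$. For $\theta\in\overline K$, $\deg\theta=[K(\theta):K]$. For $f\in K[X]$ and a positive integer $b$, $\partial_b f=\frac{1}{b!}\frac{\partial^b f}{\partial X^b}$ is the $b$-th formal (Hasse) derivative, and $\epsilon(f)=\max_{b\in\mathbb N}\frac{w(f)-w(\partial_b f)}{b}$, where $b$ runs over positive integers (an element of the divisible hull of the value group $\Gamma_w$; terms with $\partial_b f=0$ count as $-\infty$). A monic nonconstant polynomial $Q\in K[X]$ is an abstract key polynomial (ABKP) for $w$ if every $f\in K[X]$ with $\epsilon(f)\ge\epsilon(Q)$ satisfies $\deg f\ge\deg Q$. ABKPs are irreducible over $K$. The $Q$-truncation of $w$ is $w_Q(f)=\min_i\{w(f_iQ^i)\}$, where $f=\sum_i f_iQ^i$, $\deg f_i<\deg Q$, is the $Q$-expansion of $f$; for an ABKP $Q$ it is a valuation on $K(X)$. Put $\alpha(Q)=\min\{\deg f\mid w_Q(f)<w(f)\}$ ($=\infty$ if $w_Q=w$)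 and $\psi(Q)=\{f\in K[X]\mid f\text{ monic},\ w_Q(f)<w(f),\ \deg f=\alpha(Q)\}$. For an ordered set $\Delta$, a set $\{Q_i\}_{i\in\Delta}$ of ABKPs for $w$ is complete if for every $f\in K[X]$ there is $i\in\Delta$ with $w_{Q_i}(f)=w(f)$. The complete sets considered have the following properties: (1) $\Delta=\bigcup_{j\in I}\Delta_j$ with $I=\{0,\dots,N\}$ or $I=\mathbb N\cup\{0\}$, and for each $j\in I$, $\Delta_j=\{j\}\cup\vartheta_j$, where $\vartheta_j$ is an ordered set without maximal element or is empty. (2) $Q_0=X$. (3) For all $j\in I\setminus\{0\}$, $j-1<i<j$ for all $i\in\vartheta_{j-1}$. (4) All $Q_i$ with $i\in\Delta_j$ have the same degree, strictly less than the degree of $Q_{i'}$ for every $i'\in\Delta_{j+1}$. (5) For any $j\in I$: if $\alpha(Q_j)>\deg Q_j$, then $Q_{i'}\in\psi(Q_j)$ for every $i'\in\Delta_{j+1}$; if $\alpha(Q_j)=\deg Q_j$, then the set $\{w(F)\mid F\in\psi(Q_j)\}$ has no maximal element, i.e. $\vartheta_j\ne\emptyset$. (6) For $i<i'$ in $\Delta$, $w(Q_i)<w(Q_{i'})$ and $\epsilon(Q_i)<\epsilon(Q_{i'})$. (7) $\Delta$ has a maximal element if and only if $I=\{0,\dots,N\}$ is finite and $\vartheta_N=\emptyset$. A pair $(\theta,\alpha)$ of elements of $\overline K$ is a $(K,v)$-distinguished pair if: $\deg\theta>\deg\alpha$; $\bar v(\theta-\alpha)=\max\{\bar v(\theta-\beta)\mid\beta\in\overline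 K,\ \deg\beta<\deg\theta\}$; and $\bar v(\theta-\eta)<\bar v(\theta-\alpha)$ for every $\eta\in\overline K$ with $\deg\eta<\deg\alpha$. For irreducible polynomials $g,f$ over $K$, $(g,f)$ is a distinguished pair if there are a root $\theta$ of $g$ and a root $\alpha$ of $f$ such that $(\theta,\alpha)$ is a $(K,v)$-distinguished pair. A saturated distinguished chain for an element $\theta\in\overline K$ is a chain $\theta=\theta_r,\dots,\theta_0$ of elements of $\overline K$ with $(\theta_{i+1},\theta_i)$ a $(K,v)$-distinguished pair for $0\le i\le r-1$ and $\theta_0\in K$. Correspondingly, a saturated distinguished chain for an irreducible polynomial $Q$ is a chain $(Q=P_r,P_{r-1},\dots,P_0)$ of irreducible polynomials over $K$ such that $(P_i,P_{i-1})$ is a distinguished pair for $1\le i\le r$ and $\deg P_0=1$. *)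

(* Defs.v *)
From HB Require Import structures.
From mathcomp Require Import all_boot all_order all_algebra all_field.
From mathcomp Require Import boolp classical_sets.

Set Implicit Arguments.
Unset Strict Implicit.
Unset Printing Implicit Defensive.

Import Order.TTheory GRing.Theory Num.Theory.
Local Open Scope classical_set_scope.
Local Open Scope ring_scope.

(* Divisible totally ordered abelian groups, i.e. totally ordered abelian
   groups which are Q-vector spaces; all valuations below take their values in
   one such group G. The value groups themselves are the images of the
   valuations: they are arbitrary ordered abelian groups (of arbitrary rank),
   since any ordered abelian group embeds in its divisible hull. *)
HB.mixin Record Lmodule_isOrderedQMod G
    of Num.POrderedZmodule G & GRing.Lmodule rat G := {
  oqm_le_total : total (<=%R : rel G);
  oqm_leD2l : forall z x y : G, x <= y -> z + x <= z + y
}.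

#[short(type="orderedQmodType")]
HB.structure Definition OrderedQMod :=
  { G of Num.POrderedZmodule G & GRing.Lmodule rat G
       & Lmodule_isOrderedQMod G }.

(* [\bar G] of MathComp-Analysis is ordered only when G is a numDomainType. *)
Inductive ext (G : Type) : Type := Fin of G | PInf | NInf.
Arguments PInf {G}.
Arguments NInf {G}.

Definition ext_code (G : Type) (x : ext G) : G + bool :=
  match x with Fin a => inl a | PInf => inr true | NInf => inr false end.
Definition ext_decode (G : Type) (x : G + bool) : ext G :=
  match x with inl a => Fin a | inr true => PInf | inr false => NInf end.
Lemma ext_codeK (G : Type) : cancel (@ext_code G) (@ext_decode G).
Proof. by case. Qed.
HB.instance Definition _ (G : choiceType) :=
  Choice.copy (ext G) (can_type (@ext_codeK G)).

Section ExtOrder.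
Context (d : Order.disp_t) (G : porderType d).
Implicit Types x y z : ext G.

Definition ext_le x y : bool :=
  match x, y with
  | NInf, _ | _, PInf => true
  | Fin a, Fin b => (a <= b)%O
  | _, _ => false
  end.

Lemma ext_le_refl : reflexive ext_le.
Proof. by case=> //= a; exact: lexx. Qed.

Lemma ext_le_anti : antisymmetric ext_le.
Proof. by case=> [a||] [b||] //= /le_anti ->. Qed.

Lemma ext_le_trans : transitive ext_le.
Proof. by case=> [a||] [b||] [c||] //=; exact: le_trans. Qed.

HB.instance Definition _ := Order.Le_isPOrder.Build ring_display (ext G)
  ext_le_refl ext_le_anti ext_le_trans.
End ExtOrder.

Lemma ext_le_total (G : orderedQmodType) : total (<=%R : rel (ext G)).
Proof. by case=> [a||] [b||] //=; exact: oqm_le_total. Qed.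
HB.instance Definition _ (G : orderedQmodType) :=
  Order.POrder_isTotal.Build ring_display (ext G) (@ext_le_total G).

Section ExtArith.
Context (G : lmodType rat).

(* The value of +oo + -oo is a convention which is never relevant. *)
Definition ext_add (x y : ext G) : ext G :=
  match x, y with
  | Fin a, Fin b => Fin (a + b)
  | NInf, _ | _, NInf => NInf
  | _, _ => PInf
  end.

Definition ext_opp (x : ext G) : ext G :=
  match x with Fin a => Fin (- a) | PInf => NInf | NInf => PInf end.

Definition ext_divn (x : ext G) (b : nat) : ext G :=
  if x is Fin a then Fin ((b%:R : rat)^-1 *: a) else x.
End ExtArith.

Definition is_valuation (G : orderedQmodType) (F : fieldType) (v : F -> ext G)
    : Prop :=
  [/\ v 0 = PInf,
      forall x, x != 0 -> exists g, v x = Fin g,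
      forall x y, v (x * y) = ext_add (v x) (v y)
    & forall x y, Order.min (v x) (v y) <= v (x + y)].

Definition extends_val (G : Type) (F E : Type) (i : F -> E)
    (v : F -> ext G) (u : E -> ext G) : Prop :=
  forall x, u (i x) = v x.

(* v has a unique extension to the algebraic closure. As the values of an
   extension lie in the divisible hull of the value group of v, which embeds
   uniquely in G over that value group, equivalent extensions are equal. *)
Definition henselian (G : orderedQmodType) (K Kbar : fieldType)
    (iota : K -> Kbar) (v : K -> ext G) : Prop :=
  exists u : Kbar -> ext G,
    [/\ is_valuation u, extends_val iota v u
      & forall u' : Kbar -> ext G,
          is_valuation u' -> extends_val iota v u' -> u' =1 u].

Definition deg (R : nzRingType) (p : {poly R}) : nat := (size p).-1.

Section AlgebraicElements.
Context (G : orderedQmodType) (K Kbar : fieldType).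
Context (iota : {rmorphism K -> Kbar}) (vbar : Kbar -> ext G).
Implicit Types theta alpha : Kbar.

(* The subfield K(theta) of Kbar. *)
Definition adjoin theta : set Kbar :=
  [set x | exists p q : {poly K}, (map_poly iota q).[theta] != 0 /\
     x = (map_poly iota p).[theta] / (map_poly iota q).[theta]].

(* [K(theta) : K], for theta algebraic over K. *)
Definition degree theta : nat :=
  xget 0%N [set n | exists e : 'I_n -> Kbar,
    (forall i, adjoin theta (e i)) /\
    (forall x, adjoin theta x ->
       exists! c : 'rV[K]_n, x = \sum_(i < n) iota (c 0 i) * e i)].

Definition distinguished_pair theta alpha : Prop :=
  [/\ (degree alpha < degree theta)%N,
      forall beta, (degree beta < degree theta)%N ->
        vbar (theta - beta) <= vbar (theta - alpha)
    & forall eta, (degree eta < degree alpha)%N ->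
        vbar (theta - eta) < vbar (theta - alpha)].

Definition distinguished_pair_poly (g f : {poly K}) : Prop :=
  exists theta alpha : Kbar,
    [/\ root (map_poly iota g) theta, root (map_poly iota f) alpha
      & distinguished_pair theta alpha].

Definition has_saturated_distinguished_chain (Q : {poly K}) : Prop :=
  exists (r : nat) (P : nat -> {poly K}),
    [/\ P r = Q,
        forall i, (i <= r)%N -> irreducible_poly (P i),
        forall i, (i < r)%N -> distinguished_pair_poly (P i.+1) (P i)
      & deg (P 0%N) = 1%N].
End AlgebraicElements.

Section KeyPolynomials.
Context (G : orderedQmodType) (K : fieldType).
Context (w : {fraction {poly K}} -> ext G).
Implicit Types f Q : {poly K}.

Definition val_poly f : ext G := w (tofrac f).

(* The indices b >= size f, for which f^`N(b) = 0, would contribute -oo.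
   In particular epsilon f = -oo when f is constant. *)
Definition epsilon f : ext G :=
  \big[Order.max/NInf]_(1 <= b < size f)
    ext_divn (ext_add (val_poly f) (ext_opp (val_poly f^`N(b)))) b.

Definition ABKP Q : Prop :=
  [/\ Q \is monic, (0 < deg Q)%N
    & forall f, epsilon Q <= epsilon f -> (deg Q <= deg f)%N].

(* The coefficient of Q ^+ i in the Q-expansion of f, see Qcoef_expansion. *)
Definition Qcoef Q f (i : nat) : {poly K} := (f %/ Q ^+ i) %% Q.

Lemma size_Qcoef Q f i : (0 < deg Q)%N -> (deg (Qcoef Q f i) < deg Q)%N.
Proof.
rewrite /deg /Qcoef => Q1.
have Q0 : Q != 0 by apply/eqP => Q0; rewrite Q0 size_poly0 in Q1.
have := ltn_modp (f %/ Q ^+ i) Q; rewrite Q0.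
by case: (size _) (size Q) Q1 => [|m] [|n].
Qed.

Lemma Qcoef_expansion Q f : (0 < deg Q)%N ->
  f = \sum_(i < size f) Qcoef Q f i * Q ^+ i.
Proof.
rewrite /deg => Q1.
have Q0 : Q != 0 by apply/eqP => Q0; rewrite Q0 size_poly0 in Q1.
have expand n : f = f %/ Q ^+ n * Q ^+ n + \sum_(i < n) Qcoef Q f i * Q ^+ i.
  elim: n => [|n IHn]; first by rewrite big_ord0 addr0 expr0 divp1 mulr1.
  rewrite big_ord_recr /= {1}IHn {1}(divp_eq (f %/ Q ^+ n) Q).
  rewrite mulrDl -mulrA -exprS divp_divl -exprSr /Qcoef.
  by rewrite -addrA [X in _ + X]addrC.
rewrite {1}(expand (size f)) divp_small ?mul0r ?add0r //.
by rewrite (polySpred (expf_neq0 _ Q0)) ltnS size_exp leq_pmull.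
Qed.

Definition truncation Q f : ext G :=
  \big[Order.min/PInf]_(i < size f) val_poly (Qcoef Q f i * Q ^+ i).

Definition alpha Q : ext nat :=
  xget PInf [set a : ext nat |
    (exists f, truncation Q f < val_poly f /\ a = Fin (deg f)) /\
    (forall f, truncation Q f < val_poly f -> a <= Fin (deg f))].

Definition psi Q : set {poly K} :=
  [set f | [/\ f \is monic, truncation Q f < val_poly f
             & Fin (deg f) = alpha Q]].

Definition complete_ABKPs (Delta : Type) (Q : Delta -> {poly K}) : Prop :=
  (forall i, ABKP (Q i)) /\
  (forall f, exists i, truncation (Q i) f = val_poly f).

Section Indices.
Context (d : Order.disp_t) (Delta : orderType d).
Context (I : set nat) (nu : nat -> Delta) (vartheta : nat -> set Delta).

Definition Delta_ (j : nat) : set Delta := nu j |` vartheta j.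

(* I is identified with a subset of Delta through nu, whose values outside I
   are irrelevant. *)
Record structured_ABKPs (Q : Delta -> {poly K}) : Prop := {
  sA_I : I = setT \/ exists N : nat, I = [set j | (j <= N)%N];
  sA_nu : forall j k, I j -> I k -> (j < k)%N -> (nu j < nu k)%O;
  sA_cover : forall i, exists2 j, I j & Delta_ j i;
  sA_nomax : forall j, I j -> forall i, vartheta j i ->
    exists2 i', vartheta j i' & (i < i')%O;
  sA_Q0 : Q (nu 0%N) = 'X;
  sA_between : forall j, I j.+1 -> forall i, vartheta j i ->
    (nu j < i)%O /\ (i < nu j.+1)%O;
  sA_deg_eq : forall j, I j -> forall i i', Delta_ j i -> Delta_ j i' ->
    deg (Q i) = deg (Q i');
  sA_deg_lt : forall j, I j -> I j.+1 ->
    forall i i', Delta_ j i -> Delta_ j.+1 i' -> (deg (Q i) < deg (Q i'))%N;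
  sA_alpha_gt : forall j, I j -> Fin (deg (Q (nu j))) < alpha (Q (nu j)) ->
    I j.+1 -> forall i', Delta_ j.+1 i' -> psi (Q (nu j)) (Q i');
  sA_alpha_eq : forall j, I j -> alpha (Q (nu j)) = Fin (deg (Q (nu j))) ->
    ~ (exists2 F, psi (Q (nu j)) F &
         forall F', psi (Q (nu j)) F' -> val_poly F' <= val_poly F) /\
    vartheta j !=set0;
  sA_mono : forall i i', (i < i')%O ->
    val_poly (Q i) < val_poly (Q i') /\ epsilon (Q i) < epsilon (Q i');
  sA_max : (exists m : Delta, forall i, (i <= m)%O) <->
    (exists N : nat, I = [set j | (j <= N)%N] /\ vartheta N = set0)
}.
End Indices.
End KeyPolynomials.

(* Main.v *)
Require Import Defs.
From mathcomp Require Import all_boot all_order all_algebra all_field.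
From mathcomp Require Import boolp classical_sets.

Set Implicit Arguments.
Unset Strict Implicit.
Unset Printing Implicit Defensive.

Import Order.TTheory GRing.Theory.
Local Open Scope classical_set_scope.
Local Open Scope ring_scope.

(** Write delta for w(X) and f for Q_1. The X-truncation of w is the Gauss
    valuation w_X of slope delta, sending the sum of the c_i X^i to the
    minimum of the v(c_i) + i delta, and f is a monic polynomial of least
    degree n > 1 with w_X(f) < w(f). The chain (Q_1, X) is already saturated:
    for any root theta of f, the pair (theta, 0) is distinguished. As f is
    irreducible, theta has degree n, so what has to be shown is that no beta
    of degree less than n is closer to theta than 0 is
    ([minimal_monic_root_nearest]).

    Minimality forces the leading term of f to attain w_X(f), that is
    w_X(f) = n delta < w(f): otherwise it could be dropped, leaving a
    polynomial of smaller degree on which w still exceeds w_X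
    ([minimal_monic_above]). Then all roots of f have value at least delta,
    by inspection of the terms of f(theta) = 0 ([root_ge_slope]).

    Suppose that beta has degree less than n and is closer to theta than 0 is.
    Then beta also has value at least delta, and u(h) := vbar(h(beta)) is, like
    w, a valuation on polynomials (with infinite values allowed) which is
    bounded below by w_X. Moreover u(f) > n delta, since f = q (X - theta) with
    w_X(q) >= (n - 1) delta ([horner_near_root]). Now w and u single out the
    same graded prime, generated by the initial form of f, so that f has least
    degree among the polynomials with u > w_X too
    ([minimal_monic_transfer]). Concretely, let h be monic of least degree d
    with u(h) > w_X(h), hence u(h) > d delta, suppose d < n and divide:
    f = q h + r. From u(f) > n delta and u(q h) > n delta one gets
    u(r) > n delta; as r has degree less than d, w(r) >= w_X(r) >= u(r), so
    w(q h) = w(f - r) > n delta. But q and h are monic of degrees n - d and d,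
    both less than n, so w(q h) = w_X(q) + w_X(h) <= n delta. Therefore d >= n,
    which the minimal polynomial g of beta contradicts, since u(g) is infinite
    and deg g < n. *)

(** * Division by monic polynomials *)

Section Division.
Context (K : fieldType).
Implicit Types f h : {poly K}.

Lemma size_deg f : f != 0 -> size f = (deg f).+1.
Proof. by rewrite -size_poly_gt0 /deg => /prednK. Qed.

Lemma size_sub_lead f :
  f != 0 -> (size (f - lead_coef f *: 'X^(deg f))%R < size f)%N.
Proof.
move=> f0; rewrite (size_deg f0) ltnS; apply/leq_sizeP => j.
rewrite coefB coefZ coefXn leq_eqVlt => /orP[/eqP <-|lt_j].
  by rewrite eqxx mulr1 subrr.
by rewrite gtn_eqF // mulr0 subr0 nth_default // (size_deg f0).
Qed.

Lemma divp_monic f h : f \is monic -> h \is monic -> (size h <= size f)%N ->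
  f %/ h \is monic /\ (deg (f %/ h) + deg h = deg f)%N.
Proof.
move=> f_monic h_monic le_hf.
have [f0 h0] := (monic_neq0 f_monic, monic_neq0 h_monic).
have q0 : f %/ h != 0 by rewrite divp_eq0 negb_or f0 negb_or h0 -leqNgt.
have deg_q : (deg (f %/ h) + deg h = deg f)%N.
  rewrite (size_deg h0) (size_deg f0) ltnS in le_hf.
  by rewrite {1}/deg size_divp // (size_deg f0) (size_deg h0) /= subSn //= subnK.
split=> //; rewrite monicE.
have <- : lead_coef (f %/ h * h) = lead_coef (f %/ h).
  by rewrite lead_coefM (monicP h_monic) mulr1.
have := f_monic; rewrite {1}(divp_eq f h) monicE lead_coefDl //.
apply: (leq_trans (_ : _ < size h)%N); first by rewrite ltn_modp.
by rewrite size_Mmonic // (size_deg q0) addSn leq_addl.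
Qed.

End Division.

(** * Arithmetic in ordered value groups *)

Section ExtendedGroup.
Context (G : orderedQmodType).
Implicit Types (a b : G) (x y z : ext G).

Lemma ext_addC x y : ext_add x y = ext_add y x.
Proof. by case: x y => [a||] [b||] //=; rewrite addrC. Qed.

Lemma ext_addA x y z : ext_add x (ext_add y z) = ext_add (ext_add x y) z.
Proof. by case: x y z => [a||] [b||] [c||] //=; rewrite addrA. Qed.

Lemma ext_add0 x : ext_add x (Fin 0) = x.
Proof. by case: x => [a||] //=; rewrite addr0. Qed.

Lemma ext_leD x y x' y' :
  x <= x' -> y <= y' -> ext_add x y <= ext_add x' y'.
Proof.
have leD2r a b c : a <= b -> a + c <= b + c.
  by rewrite ![_ + c]addrC; exact: oqm_leD2l.
case: x x' y y' => [a||] [a'||] [b||] [b'||] // le_a le_b.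
exact: le_trans (leD2r _ _ _ le_a) (oqm_leD2l _ _ _ le_b).
Qed.

Lemma ext_addK x a : ext_add (ext_add x (Fin a)) (Fin (- a)) = x.
Proof. by rewrite -ext_addA /= subrr ext_add0. Qed.

Lemma ext_leD2r x y a :
  (ext_add x (Fin a) <= ext_add y (Fin a)) = (x <= y).
Proof.
apply/idP/idP => [le_xy|le_xy]; last exact: ext_leD.
by rewrite -(ext_addK x a) -(ext_addK y a); apply: ext_leD.
Qed.

Lemma ext_ltD2r x y a :
  (ext_add x (Fin a) < ext_add y (Fin a)) = (x < y).
Proof. by rewrite !ltNge ext_leD2r. Qed.

Lemma ext_lt_leD a b x y :
  Fin a < x -> Fin b <= y -> Fin (a + b) < ext_add x y.
Proof.
move=> lt_x le_y; apply: (@lt_le_trans _ _ (ext_add x (Fin b))).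
  by rewrite -(ext_ltD2r _ _ b) in lt_x.
exact: ext_leD.
Qed.

Lemma ext_ltMn a b k : (0 < k)%N -> Fin a < Fin b -> Fin (a *+ k) < Fin (b *+ k).
Proof.
case: k => // k _ lt_ab; elim: k => // k IHk.
by rewrite !(mulrS _ k.+1); exact: (ext_lt_leD lt_ab (ltW IHk)).
Qed.

(** 2 acts invertibly on a Q-vector space; hence the value of -1 is 0. *)
Lemma double_eq0 a : a + a = 0 -> a = 0.
Proof.
move=> aa0; have: (2 : rat) *: a = 0 by rewrite scaler_nat mulr2n.
by move/eqP; rewrite scaler_eq0 => /orP[//|/eqP].
Qed.

End ExtendedGroup.

(** * Valuations *)

Section Valuation.
Context (G : orderedQmodType) (E : fieldType) (mu : E -> ext G).
Hypothesis mu_val : is_valuation mu.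
Implicit Types (x y : E) (a : G) (c : ext G).

Lemma valuation0 : mu 0 = PInf.
Proof. by case: mu_val. Qed.

Lemma valuation_fin x : x != 0 -> exists a, mu x = Fin a.
Proof. by case: mu_val => _ + _ _; apply. Qed.

Lemma valuationM x y : mu (x * y) = ext_add (mu x) (mu y).
Proof. by case: mu_val. Qed.

Lemma valuation1 : mu 1 = Fin 0.
Proof.
have [a mu1] := valuation_fin (oner_neq0 E).
have := valuationM 1 1; rewrite mulr1 mu1 => -[/esym/eqP].
by rewrite -subr_eq0 addrK => /eqP->.
Qed.

Lemma valuationN x : mu (- x) = mu x.
Proof.
have [a muN1] : exists a, mu (-1) = Fin a.
  by apply: valuation_fin; rewrite oppr_eq0 oner_neq0.
have := valuationM (-1) (-1); rewrite mulrNN mulr1 valuation1 muN1.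
move=> -[/esym/double_eq0 a0].
by rewrite -mulN1r valuationM muN1 a0 ext_addC ext_add0.
Qed.

Lemma valuationD_ge c x y : c <= mu x -> c <= mu y -> c <= mu (x + y).
Proof.
move=> le_x le_y; case: mu_val => _ _ _ /(_ x y); apply: le_trans.
by rewrite le_min le_x.
Qed.

Lemma valuationD_gt c x y : c < mu x -> c < mu y -> c < mu (x + y).
Proof.
move=> le_x le_y; case: mu_val => _ _ _ /(_ x y); apply: lt_le_trans.
by rewrite lt_min le_x.
Qed.

Lemma valuation_sum_ge (T : finType) (F : T -> E) c :
  (forall i, c <= mu (F i)) -> c <= mu (\sum_i F i).
Proof.
move=> le_F; apply: (big_ind (fun x => c <= mu x)) => //; last exact: valuationD_ge.
by rewrite valuation0; case: c {le_F}.
Qed.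

Lemma valuation_sum_gt (T : finType) (F : T -> E) a :
  (forall i, Fin a < mu (F i)) -> Fin a < mu (\sum_i F i).
Proof.
move=> lt_F; apply: (big_ind (fun x => Fin a < mu x)) => //; last exact: valuationD_gt.
by rewrite valuation0.
Qed.

Lemma valuationX x a n : mu x = Fin a -> mu (x ^+ n) = Fin (a *+ n).
Proof.
move=> mux; elim: n => [|n IHn]; first by rewrite valuation1.
by rewrite exprS valuationM IHn mux mulrS.
Qed.

Lemma valuationX_ge x a n : Fin a <= mu x -> Fin (a *+ n) <= mu (x ^+ n).
Proof.
move=> le_x; elim: n => [|n IHn]; first by rewrite valuation1 mulr0n.
by rewrite exprS valuationM mulrS; apply: (ext_leD le_x IHn).
Qed.

End Valuation.

(** * The Gauss valuation of slope delta *)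

Section Gauss.
Context (G : orderedQmodType) (K : fieldType) (v : K -> ext G).
Hypothesis v_val : is_valuation v.
Context (delta : G).
Implicit Types (f g h q : {poly K}) (a b : G) (c : ext G).

Definition gauss f : ext G :=
  \big[Order.min/PInf]_(i < size f) ext_add (v f`_i) (Fin (delta *+ i)).

(** In this form the bound quantifies over all coefficients, those past the
    degree having infinite value. *)
Lemma gaussP c f :
  reflect (forall i, c <= ext_add (v f`_i) (Fin (delta *+ i))) (c <= gauss f).
Proof.
apply: (iffP (bigmin_geP _ _ _ _)) => [[_ le_f] i|le_f].
  have [lt_i|ge_i] := ltnP i (size f); first exact: (le_f (Ordinal lt_i) isT).
  by rewrite nth_default // valuation0 //; case: c {le_f}.
by split=> [|i _]; [case: c {le_f} | exact: le_f].
Qed.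

Lemma gauss_le_coef f i : gauss f <= ext_add (v f`_i) (Fin (delta *+ i)).
Proof. by move: i; apply/gaussP. Qed.

Lemma gaussD_ge c f g : c <= gauss f -> c <= gauss g -> c <= gauss (f + g).
Proof.
move=> /gaussP le_f /gaussP le_g; apply/gaussP => i; rewrite coefD.
(* Only the values of the coefficients are left once i delta is subtracted. *)
rewrite -(ext_leD2r _ _ (- (delta *+ i))) ext_addK.
by apply: valuationD_ge => //;
   rewrite -(ext_leD2r _ _ (delta *+ i)) -ext_addA /= addNr ext_add0.
Qed.

Lemma gaussM_ge a b f g :
  Fin a <= gauss f -> Fin b <= gauss g -> Fin (a + b) <= gauss (f * g).
Proof.
move=> /gaussP le_f /gaussP le_g; apply/gaussP => i; rewrite coefM.
rewrite -(ext_leD2r _ _ (- (delta *+ i))) ext_addK.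
apply: valuation_sum_ge => // j; rewrite valuationM //.
rewrite -(ext_leD2r _ _ (delta *+ i)) -ext_addA /= addNr addr0.
have -> : delta *+ i = delta *+ j + delta *+ (i - j).
  by rewrite -mulrnDr subnKC // leq_ord.
have := ext_leD (le_f j) (le_g (i - j)%N); congr (_ <= _).
rewrite -!ext_addA; congr ext_add; rewrite ext_addC -ext_addA; congr ext_add.
by rewrite /= addrC.
Qed.

Lemma gauss_monomial_ge a (k : K) n :
  Fin a <= ext_add (v k) (Fin (delta *+ n)) -> Fin a <= gauss (k *: 'X^n).
Proof.
move=> le_a; apply/gaussP => i; rewrite coefZ coefXn.
by case: eqP => [->|_]; rewrite ?mulr1 // mulr0 valuation0.
Qed.

Lemma gauss_le_lead f :
  gauss f <= ext_add (v (lead_coef f)) (Fin (delta *+ deg f)).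
Proof. exact: gauss_le_coef. Qed.

Lemma gauss_monic_le f : f \is monic -> gauss f <= Fin (delta *+ deg f).
Proof.
by move=> /monicP f1; have := gauss_le_lead f; rewrite f1 valuation1 //= add0r.
Qed.

Lemma gauss_neq0 f : f != 0 -> gauss f < PInf.
Proof.
rewrite -lead_coef_eq0 => /(valuation_fin v_val)[a va].
by apply: le_lt_trans (gauss_le_lead f) _; rewrite va.
Qed.

(** Dividing by a monic h whose leading term attains its Gauss value keeps all
    steps of the division algorithm within the Gauss bound of f. *)
Lemma gauss_divp h f a : h \is monic -> Fin (delta *+ deg h) <= gauss h ->
  Fin a <= gauss f -> Fin (a - delta *+ deg h) <= gauss (f %/ h).
Proof.
move=> h_monic le_h; have h0 := monic_neq0 h_monic.
have [n] := ubnP (size f); elim: n f => // n IHn f /ltnSE le_fn le_f.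
have [lt_fh|le_hf] := ltnP (size f) (size h).
  rewrite divp_small //; apply/gaussP => i; rewrite coef0 valuation0 //.
have f0 : f != 0 by rewrite -size_poly_gt0 (leq_trans _ le_hf) // size_poly_gt0.
have le_deg : (deg h <= deg f)%N by rewrite !size_deg in le_hf.
(* One step of the division algorithm cancels the leading term of f with m h. *)
pose k := (deg f - deg h)%N; pose m := lead_coef f *: 'X^k.
have le_m : Fin (a - delta *+ deg h) <= gauss m.
  apply: gauss_monomial_ge.
  rewrite -(ext_leD2r _ _ (delta *+ deg h)) /= subrK -ext_addA /= -mulrnDr subnK //.
  by apply: le_trans le_f _; exact: gauss_le_lead.
have le_mh : Fin a <= gauss (m * h).
  by have := gaussM_ge le_m le_h; rewrite subrK.
have m0 : m != 0 by rewrite scaler_eq0 negb_or lead_coef_eq0 f0 monic_neq0 // monicXn.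
have mh0 : m * h != 0 by rewrite mulf_neq0.
have lead_m : lead_coef (m * h) = lead_coef f.
  by rewrite lead_coefM lead_coefZ lead_coefXn (monicP h_monic) !mulr1.
have deg_m : deg (m * h) = deg f.
  rewrite /deg size_Mmonic // size_scale ?lead_coef_eq0 // size_polyXn /=.
  by rewrite (size_deg h0) addnS /= subnK.
have lt_size : (size (f - m * h)%R < size f)%N.
  have := size_sub_lead mh0; rewrite lead_m deg_m (size_deg mh0) deg_m -(size_deg f0).
  move: (size_sub_lead f0); set z := _ *: _ => lt_f lt_m.
  have -> : f - m * h = (f - z) - (m * h - z) by rewrite opprB addrA subrK.
  by apply: leq_ltn_trans (size_polyD _ _) _; rewrite gtn_max lt_f size_polyN.
have -> : f %/ h = m + (f - m * h) %/ h.
  by rewrite divpD divpN mulpK // addrC subrK.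
apply: gaussD_ge => //; apply: IHn; first exact: leq_trans lt_size le_fn.
apply: gaussD_ge => //; apply/gaussP => i; rewrite coefN valuationN //.
by move/gaussP: le_mh; apply.
Qed.

End Gauss.

(** * Valuations above the Gauss valuation *)

Section AboveGauss.
Context (G : orderedQmodType) (K E : fieldType).
Context (v : K -> ext G) (mu : E -> ext G) (phi : {rmorphism {poly K} -> E}).
Context (delta : G).
Hypotheses (v_val : is_valuation v) (mu_val : is_valuation mu).
Hypothesis phiC : forall c, mu (phi c%:P) = v c.
Hypothesis phiX : Fin delta <= mu (phi 'X).
Implicit Types (f g h : {poly K}).
Local Notation gauss := (gauss v delta).

(** The Gauss valuation is the least one that has the given values on constants
    and value at least delta on X. The morphism phi will be the inclusion of K[X] in K(X), or
    evaluation at an algebraic element; in the latter case the composite takes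
    infinite values on non-zero polynomials. *)
Lemma gauss_le f : gauss f <= mu (phi f).
Proof.
rewrite -[X in mu (phi X)]coefK poly_def rmorph_sum; apply: valuation_sum_ge => // i.
rewrite -mul_polyC rmorphM rmorphXn valuationM // phiC.
apply: le_trans (gauss_le_coef v_val delta f i) _.
by apply: ext_leD => //; apply: valuationX_ge.
Qed.

Lemma gauss_lt_scale c f : c != 0 ->
  gauss f < mu (phi f) -> gauss (c *: f) < mu (phi (c *: f)).
Proof.
move=> /(valuation_fin v_val)[a va]; rewrite !ltNge; apply: contra => /(gaussP v_val) le_cf.
apply/(gaussP v_val) => i; rewrite -(ext_leD2r _ _ a).
have := le_cf i; rewrite coefZ -mul_polyC rmorphM !valuationM // phiC va.
by rewrite -ext_addA !(ext_addC (Fin a)).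
Qed.

(** If the leading term of f did not attain gauss f, removing it would change
    neither gauss f nor the fact that mu exceeds it, against minimality. *)
Lemma minimal_monic_above f : f \is monic -> gauss f < mu (phi f) ->
    (forall g, (size g < size f)%N -> mu (phi g) <= gauss g) ->
  Fin (delta *+ deg f) <= gauss f /\ Fin (delta *+ deg f) < mu (phi f).
Proof.
move=> f_monic lt_f min_f; set c := Fin _.
have c_Xn : c <= gauss 'X^(deg f).
  rewrite -[X in gauss X]scale1r; apply: gauss_monomial_ge => //.
  by rewrite valuation1 //= add0r.
pose g := f - 'X^(deg f).
have le_g z : z <= c -> z <= mu (phi f) -> z <= gauss g.
  move=> le_zc le_zf; apply: le_trans (min_f g _).
    rewrite rmorphB; apply: valuationD_ge => //; rewrite valuationN //.
    by apply: le_trans (gauss_le _); apply: le_trans c_Xn.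
  by have := size_sub_lead (monic_neq0 f_monic); rewrite (monicP f_monic) scale1r.
have le_f z : z <= c -> z <= mu (phi f) -> z <= gauss f.
  move=> le_zc le_zf; rewrite -[f](subrK 'X^(deg f)); apply: gaussD_ge => //.
    exact: le_g.
  exact: le_trans c_Xn.
have lt_c : c < mu (phi f).
  by rewrite ltNge; apply: contraL lt_f => le_fc; rewrite -leNgt le_f.
by split=> //; apply: le_f => //; exact: ltW.
Qed.

(** The factors of a reducible f would have smaller degree, hence values at
    most those of their leading terms, and these add up to the value of the
    leading term of f. *)
Lemma minimal_monic_irreducible f : f \is monic -> (1 < size f)%N ->
    gauss f < mu (phi f) ->
    (forall g, (size g < size f)%N -> mu (phi g) <= gauss g) ->
  irreducible_poly f.
Proof.
move=> f_monic size_f lt_f min_f; split=> // q size_q /dvdpP[r Df].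
have [_] := minimal_monic_above f_monic lt_f min_f.
have f0 := monic_neq0 f_monic.
have [r0 q0] : r != 0 /\ q != 0 by apply/norP; rewrite -mulf_eq0 -Df.
have q_f : q %| f by apply/dvdpP; exists r.
apply: contraTT; rewrite -dvdp_size_eqp // => neq_size; rewrite -leNgt.
have lt_q : (size q < size f)%N by rewrite ltn_neqAle neq_size dvdp_leq.
have lt_r : (size r < size f)%N.
  rewrite Df size_mul // -(prednK (_ : 0 < size q)%N) ?size_poly_gt0 // addnS /=.
  rewrite -[X in (X < _)%N]addn0 ltn_add2l.
  by move: size_q q0; rewrite -size_poly_gt0; case: (size q) => [|[]].
have le_qr := ext_leD (le_trans (min_f r lt_r) (gauss_le_lead v_val delta r))
                      (le_trans (min_f q lt_q) (gauss_le_lead v_val delta q)).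
rewrite {1}Df rmorphM valuationM //; apply: le_trans le_qr _.
rewrite -!lead_coef_eq0 in r0 q0.
have [a va] := valuation_fin v_val r0; have [b vb] := valuation_fin v_val q0.
rewrite !lead_coef_eq0 in r0 q0.
have : v (lead_coef r * lead_coef q) = Fin 0.
  by rewrite -lead_coefM -Df (monicP f_monic) valuation1.
rewrite valuationM // va vb => -[ab0].
rewrite /= addrACA ab0 add0r -mulrnDr /deg Df size_mul //.
by rewrite (size_deg r0) (size_deg q0) /= addnS.
Qed.

End AboveGauss.

(** The degree of f is minimal for both valuations: a monic h of smaller
    minimal degree for mu2 would give f = q h + r where mu2, and then mu1,
    exceeds deg f * delta on r, forcing mu1 to do so on q h, whose factors are
    too small for mu1 to exceed the Gauss value there. *)
Lemma minimal_monic_transfer (G : orderedQmodType) (K E1 E2 : fieldType)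
    (v : K -> ext G) (delta : G)
    (mu1 : E1 -> ext G) (phi1 : {rmorphism {poly K} -> E1})
    (mu2 : E2 -> ext G) (phi2 : {rmorphism {poly K} -> E2}) (f : {poly K}) :
    is_valuation v -> is_valuation mu1 -> is_valuation mu2 ->
    (forall c, mu1 (phi1 c%:P) = v c) -> Fin delta <= mu1 (phi1 'X) ->
    (forall c, mu2 (phi2 c%:P) = v c) -> Fin delta <= mu2 (phi2 'X) ->
    f \is monic -> gauss v delta f < mu1 (phi1 f) ->
    (forall g : {poly K}, (size g < size f)%N -> mu1 (phi1 g) <= gauss v delta g) ->
    Fin (delta *+ deg f) < mu2 (phi2 f) ->
  forall g : {poly K}, (size g < size f)%N -> mu2 (phi2 g) <= gauss v delta g.
Proof.
move=> v_val mu1_val mu2_val C1 X1 C2 X2 f_monic lt1_f min1_f lt2_f.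
have f0 := monic_neq0 f_monic.
have [le_f _] := minimal_monic_above v_val mu1_val C1 X1 f_monic lt1_f min1_f.
have [_ {}lt1_f] := minimal_monic_above v_val mu1_val C1 X1 f_monic lt1_f min1_f.
move=> g; have [n] := ubnP (size g); elim: n g => // n IHn g /ltnSE le_gn lt_gf.
rewrite leNgt; apply/negP => lt2_g.
have g0 : g != 0.
  apply: contraTneq lt2_g => ->; rewrite -leNgt; apply/(gaussP v_val) => i.
  by rewrite coef0 valuation0 //; case: (mu2 _).
pose h := (lead_coef g)^-1 *: g.
have l0 : (lead_coef g)^-1 != 0 by rewrite invr_eq0 lead_coef_eq0.
have h_monic : h \is monic by rewrite monicE lead_coefZ mulVf ?lead_coef_eq0.
have size_h : size h = size g by rewrite size_scale.
have lt2_h := gauss_lt_scale v_val mu2_val C2 l0 lt2_g.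
rewrite -/h in lt2_h.
have min2_h (k : {poly K}) : (size k < size h)%N -> mu2 (phi2 k) <= gauss v delta k.
  rewrite size_h => lt_k; apply: IHn; first exact: leq_trans lt_k le_gn.
  exact: ltn_trans lt_gf.
have [le_h {}lt2_h] := minimal_monic_above v_val mu2_val C2 X2 h_monic lt2_h min2_h.
rewrite -size_h in lt_gf; have h0 := monic_neq0 h_monic.
(* A positive degree for h is what makes q smaller than f. *)
have h_gt0 : (0 < deg h)%N.
  rewrite lt0n; apply: contraTneq lt2_h => deg_h.
  have /size1_polyC Dh : (size h <= 1)%N by rewrite size_deg // deg_h.
  have := h_monic; rewrite {1}Dh monicE lead_coefC => /eqP h00.
  by rewrite -leNgt deg_h Dh C2 h00 valuation1.
pose q := f %/ h; pose r := f %% h.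
have Df : f = q * h + r by exact: divp_eq.
have size_r : (size r < size h)%N by rewrite ltn_modp.
have [q_monic deg_q] := divp_monic f_monic h_monic (ltnW lt_gf).
have lt_q : (size q < size f)%N.
  rewrite (size_deg f0) size_deg ?monic_neq0 // ltnS -deg_q -[X in (X < _)%N]addn0.
  by rewrite ltn_add2l.
have le_q := gauss_divp v_val h_monic le_h le_f.
have lt2_r : Fin (delta *+ deg f) < mu2 (phi2 r).
  have -> : r = f - q * h by rewrite {1}Df addrAC subrr add0r.
  rewrite rmorphB rmorphM; apply: valuationD_gt => //; rewrite valuationN // valuationM //.
  rewrite -{1}[delta *+ deg f](subrK (delta *+ deg h)) ext_addC addrC.
  apply: ext_lt_leD => //; exact: le_trans (gauss_le v_val mu2_val C2 X2 q).
have lt1_r : Fin (delta *+ deg f) < mu1 (phi1 r).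
  apply: lt_le_trans (gauss_le v_val mu1_val C1 X1 r).
  exact: lt_le_trans (min2_h r size_r).
have : Fin (delta *+ deg f) < mu1 (phi1 (q * h)).
  have -> : q * h = f - r by rewrite {1}Df addrK.
  by rewrite rmorphB; apply: valuationD_gt => //; rewrite valuationN.
rewrite rmorphM valuationM // ltNge => /negP; apply.
rewrite -deg_q mulrnDr.
exact: (ext_leD (le_trans (min1_f q lt_q) (gauss_monic_le v_val delta q_monic))
                (le_trans (min1_f h lt_gf) (gauss_monic_le v_val delta h_monic))).
Qed.

(** * Degrees of algebraic elements *)

Section Degree.
Context (K L : fieldType) (iota : {rmorphism K -> L}).
Implicit Types (f p q : {poly K}) (theta : L) (S : set L).

(** The bases by which [degree] is defined. *)
Definition coord_basis S n (e : 'I_n -> L) : Prop :=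
  (forall i, S (e i)) /\
  (forall x, S x -> exists! c : 'rV[K]_n, x = \sum_(i < n) iota (c 0 i) * e i).

(** The two matrices of change of basis compose to the identity, by uniqueness
    of coordinates. *)
Lemma coord_basis_leq S m n (e : 'I_m -> L) (e' : 'I_n -> L) :
  coord_basis S e -> coord_basis S e' -> (m <= n)%N.
Proof.
move=> [Se e_basis] [Se' e'_basis].
have /boolp.choice[a Da] i : exists a : 'rV[K]_n, e i = \sum_j iota (a 0 j) * e' j.
  by have [c [-> _]] := e'_basis _ (Se i); exists c.
have /boolp.choice[b Db] j : exists b : 'rV[K]_m, e' j = \sum_k iota (b 0 k) * e k.
  by have [c [-> _]] := e_basis _ (Se' j); exists c.
pose A := \matrix_(i, j) a i 0 j; pose B := \matrix_(j, k) b j 0 k.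
apply: (@mulmx1_min _ _ _ A B); apply/row_matrixP => i.
have [c [_ c_uniq]] := e_basis _ (Se i).
transitivity c; last first; [symmetry | ]; symmetry; apply: c_uniq.
- rewrite (bigD1 i) //= !mxE eqxx rmorph1 mul1r big1 ?addr0 // => k neq_ki.
  by rewrite !mxE eq_sym (negPf neq_ki) rmorph0 mul0r.
- rewrite Da; under eq_bigr => j _ do rewrite Db mulr_sumr.
  rewrite exchange_big; apply: eq_bigr => k _; rewrite !mxE rmorph_sum mulr_suml.
  by apply: eq_bigr => j _; rewrite !mxE rmorphM mulrA.
Qed.

Lemma irreducible_Bezout f q : irreducible_poly f -> ~~ (f %| q) ->
  exists u, u.1 * f + u.2 * q = 1.
Proof.
by move=> irr_f nf_q; apply/Bezout_eq1_coprimepP; rewrite irreducible_poly_coprime.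
Qed.

Lemma irreducible_root_dvdp f q theta : irreducible_poly f ->
  root (map_poly iota f) theta -> root (map_poly iota q) theta -> f %| q.
Proof.
move=> irr_f /rootP f0 /rootP q0; apply: contraT => /(irreducible_Bezout irr_f)[u].
move=> /(congr1 (fun p => (map_poly iota p).[theta])) /eqP.
by rewrite rmorphD !rmorphM rmorph1 !hornerE f0 q0 !mulr0 addr0 eq_sym oner_eq0.
Qed.

(** Quotients of polynomials in theta are polynomials in theta by a Bezout
    relation with f, and these reduce modulo f. *)
Lemma power_basis f theta : irreducible_poly f -> root (map_poly iota f) theta ->
  coord_basis (adjoin iota theta) (fun i : 'I_(deg f) => theta ^+ i).
Proof.
move=> irr_f f_theta; have f0 := irredp_neq0 irr_f.
have evE (c : 'rV[K]_(deg f)) :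
    \sum_i iota (c 0 i) * theta ^+ i = (map_poly iota (rVpoly c)).[theta].
  rewrite (@horner_coef_wide _ (deg f)) ?size_map_poly ?size_poly //.
  by apply: eq_bigr => i _; rewrite coef_map coef_rVpoly_ord.
split=> [i | x [p [q [q_theta ->]]]].
  exists 'X^i, 1; rewrite rmorph1 hornerC oner_neq0 divr1.
  by rewrite map_polyXn hornerXn.
have [u Du] : exists u, u.1 * f + u.2 * q = 1.
  apply: irreducible_Bezout => //; apply: contra q_theta => /dvdpP[g ->].
  by rewrite rmorphM hornerM (rootP f_theta) mulr0.
have Dx : (map_poly iota p).[theta] / (map_poly iota q).[theta]
        = (map_poly iota ((p * u.2) %% f)).[theta].
  have := congr1 (fun g => (map_poly iota g).[theta]) (divp_eq (p * u.2) f).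
  rewrite rmorphD !rmorphM !hornerE (rootP f_theta) mulr0 add0r => <-.
  have := congr1 (fun g => (map_poly iota g).[theta]) Du.
  rewrite rmorphD !rmorphM rmorph1 !hornerE (rootP f_theta) mulr0 add0r => u2q.
  by apply: (mulIf q_theta); rewrite divfK // -mulrA u2q mulr1.
exists (poly_rV ((p * u.2) %% f)); split.
  rewrite evE poly_rV_K // -ltnS -size_deg // ltn_modp //.
move=> c; rewrite Dx evE => /eqP; rewrite -subr_eq0 -hornerN -hornerD -rmorphB => Dc.
have : f %| (p * u.2) %% f - rVpoly c.
  exact: irreducible_root_dvdp f_theta _.
move=> /dvdp_leq le_f; have [/subr0_eq ->|/le_f] := eqVneq ((p * u.2) %% f - rVpoly c) 0.
  exact: rVpolyK.
rewrite leqNgt => /negP[]; apply: leq_ltn_trans (size_polyD _ _) _.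
rewrite gtn_max ltn_modp f0 size_polyN (size_deg f0) ltnS size_poly //.
Qed.

Lemma degree_irreducible f theta :
  irreducible_poly f -> root (map_poly iota f) theta -> degree iota theta = deg f.
Proof.
move=> irr_f f_theta; have f_basis := power_basis irr_f f_theta.
apply: xget_unique => [|n [e e_basis]]; first by eexists; exact: f_basis.
apply/eqP; rewrite eqn_leq (coord_basis_leq e_basis f_basis) /=.
exact: coord_basis_leq f_basis e_basis.
Qed.

End Degree.

Lemma exists_irreducible_root (K : fieldType) (L : closedFieldType)
    (iota : {rmorphism K -> L}) (x : L) : algebraicOver iota x ->
  exists2 f : {poly K}, irreducible_poly f & root (map_poly iota f) x.
Proof.
move=> /integral_algebraic x_int.
have decK : decidable_embedding iota.
  by move=> y; exact: pselect.
by have [f [_ f_x irr_f]] := minPoly_decidable_closure decK x_int; exists f.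
Qed.

(** * Roots and the Gauss valuation *)

Section Roots.
Context (G : orderedQmodType) (L : fieldType) (mu : L -> ext G).
Hypothesis mu_val : is_valuation mu.
Context (delta : G) (f : {poly L}).
Hypotheses (f_monic : f \is monic) (le_f : Fin (delta *+ deg f) <= gauss mu delta f).

(** If theta had value less than delta, the leading term would be the only one
    of least value in f(theta) = 0. *)
Lemma root_ge_slope theta : root f theta -> Fin delta <= mu theta.
Proof.
move=> f_theta; rewrite leNgt; apply/negP => lt_theta.
have theta0 : theta != 0.
  by apply: contraTneq lt_theta => ->; rewrite valuation0.
have [t mu_theta] := valuation_fin mu_val theta0; rewrite mu_theta in lt_theta.
suff : Fin (t *+ deg f) < mu (theta ^+ deg f).
  by rewrite (valuationX mu_val _ mu_theta) ltxx.
have -> : theta ^+ deg f = - \sum_(i < deg f) f`_i * theta ^+ i.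
  move: (rootP f_theta); rewrite horner_coef (size_deg (monic_neq0 f_monic)).
  rewrite big_ord_recr /= -/(lead_coef f) (monicP f_monic) mul1r.
  by move/eqP; rewrite addrC addr_eq0 => /eqP.
rewrite valuationN //; apply: valuation_sum_gt => // -[i lt_i] /=.
(* Adding i delta exposes v(f_i) + i delta, which is at least deg f * delta. *)
rewrite valuationM // (valuationX mu_val _ mu_theta) -(ext_ltD2r _ _ (delta *+ i)).
rewrite -ext_addA [ext_add (Fin (t *+ i)) _]ext_addC ext_addA.
apply: (lt_le_trans _ (ext_leD (gaussP mu_val _ _ _ le_f i) (lexx _))).
rewrite /= -(subnK (ltnW lt_i)) !mulrnDr -!addrA [delta *+ i + _]addrC.
apply: (@ext_lt_leD _ _ _ (Fin _) (Fin _)) => //.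
by apply: ext_ltMn; rewrite ?subn_gt0.
Qed.

(** In f = q (X - theta) the factor q(beta) has value at least
    (deg f - 1) delta, by [gauss_divp]. *)
Lemma horner_near_root theta beta : root f theta -> Fin delta <= mu beta ->
  Fin delta < mu (beta - theta) -> Fin (delta *+ deg f) < mu f.[beta].
Proof.
move=> f_theta le_beta lt_beta; have le_theta := root_ge_slope f_theta.
have deg_X : deg ('X - theta%:P) = 1%N by rewrite /deg size_XsubC.
have le_X : Fin (delta *+ deg ('X - theta%:P)) <= gauss mu delta ('X - theta%:P).
  rewrite deg_X; apply/(gaussP mu_val) => -[|[|i]]; rewrite coefB coefX coefC /=.
  - by rewrite sub0r valuationN // ext_add0.
  - by rewrite subr0 valuation1 //= add0r.
  - by rewrite subr0 valuation0.
have le_q := gauss_divp mu_val (monicXsubC theta) le_X le_f.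
have -> : f.[beta] = (beta - theta) * (f %/ ('X - theta%:P)).[beta].
  have /divpK {1}<- : 'X - theta%:P %| f by rewrite -root_factor_theorem.
  by rewrite hornerM hornerXsubC mulrC.
rewrite deg_X in le_q; rewrite valuationM // -[_ *+ _](subrK delta) addrC.
apply: ext_lt_leD => //; apply: le_trans le_q _.
apply: (gauss_le (phi := horner_eval beta)) => // [c|].
  by rewrite /= horner_evalE hornerC.
by rewrite /= horner_evalE hornerX.
Qed.

End Roots.

Section MinimalPolynomial.
Context (G : orderedQmodType) (K : fieldType) (Kbar : closedFieldType).
Context (iota : {rmorphism K -> Kbar}).
Hypothesis Kbar_algebraic : forall x : Kbar, algebraicOver iota x.
Context (v : K -> ext G) (vbar : Kbar -> ext G).
Hypotheses (v_val : is_valuation v) (vbar_val : is_valuation vbar).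
Hypothesis vbar_extends : extends_val iota v vbar.

Lemma degree_gt0 theta : (0 < degree iota theta)%N.
Proof.
have [f irr_f f_theta] := exists_irreducible_root (Kbar_algebraic theta).
have [size_f _] := irr_f.
by rewrite (degree_irreducible irr_f f_theta) -ltnS -(size_deg (irredp_neq0 irr_f)).
Qed.

Lemma degree0 : degree iota 0 = 1%N.
Proof.
have irr_X : irreducible_poly ('X : {poly K}).
  by have := irredp_XsubC (0 : K); rewrite subr0.
by rewrite (degree_irreducible irr_X) ?map_polyX ?rootX // /deg size_polyX.
Qed.

Context (E : fieldType) (mu : E -> ext G) (phi : {rmorphism {poly K} -> E}).
Context (delta : G).
Hypothesis mu_val : is_valuation mu.
Hypothesis phiC : forall c, mu (phi c%:P) = v c.
Hypothesis phiX : Fin delta <= mu (phi 'X).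
Context (f : {poly K}) (theta : Kbar).
Hypotheses (f_monic : f \is monic) (deg_f : (1 < deg f)%N).
Hypothesis lt_f : gauss v delta f < mu (phi f).
Hypothesis min_f :
  forall g : {poly K}, (size g < size f)%N -> mu (phi g) <= gauss v delta g.
Hypothesis f_theta : root (map_poly iota f) theta.

Lemma minimal_monic_degree : degree iota theta = deg f.
Proof.
apply: degree_irreducible f_theta.
apply: (minimal_monic_irreducible v_val mu_val phiC phiX) => //.
by rewrite (size_deg (monic_neq0 f_monic)) ltnS ltnW.
Qed.

Lemma gauss_map (h : {poly K}) : gauss vbar delta (map_poly iota h) = gauss v delta h.
Proof.
rewrite /gauss size_map_poly; apply: eq_bigr => i _.
by rewrite coef_map vbar_extends.
Qed.

(** If beta were closer to theta than 0 is, evaluation at beta would not exceed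
    the Gauss valuation below the degree of f, by [minimal_monic_transfer]; but
    it does so on the minimal polynomial of beta. *)
Lemma minimal_monic_root_nearest beta : (degree iota beta < deg f)%N ->
  vbar (theta - beta) <= vbar theta.
Proof.
move=> lt_beta.
have [le_f _] := minimal_monic_above v_val mu_val phiC phiX f_monic lt_f min_f.
have F_monic : map_poly iota f \is monic by rewrite map_monic.
have deg_F : deg (map_poly iota f) = deg f by rewrite /deg size_map_poly.
have le_F : Fin (delta *+ deg (map_poly iota f)) <= gauss vbar delta (map_poly iota f).
  by rewrite gauss_map deg_F.
have le_theta := root_ge_slope vbar_val F_monic le_F f_theta.
rewrite leNgt; apply/negP => lt_theta.
have le_beta : Fin delta <= vbar beta.
  rewrite -[beta](subKr theta); apply: valuationD_ge => //.
  by rewrite valuationN // (le_trans le_theta) // ltW.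
have lt2_f : Fin (delta *+ deg f) < vbar (map_poly iota f).[beta].
  rewrite -deg_F; apply: (horner_near_root vbar_val F_monic le_F f_theta) => //.
  by rewrite -valuationN // opprB; exact: le_lt_trans lt_theta.
have [g irr_g g_beta] := exists_irreducible_root (Kbar_algebraic beta).
have lt_g : (size g < size f)%N.
  rewrite (size_deg (irredp_neq0 irr_g)) (size_deg (monic_neq0 f_monic)) ltnS.
  by rewrite -(degree_irreducible irr_g g_beta).
pose ev : {rmorphism {poly K} -> Kbar} := horner_eval beta \o map_poly iota.
have evC c : vbar (ev c%:P) = v c.
  by rewrite /= horner_evalE map_polyC hornerC vbar_extends.
have evX : Fin delta <= vbar (ev 'X) by rewrite /= horner_evalE map_polyX hornerX.
have := minimal_monic_transfer v_val mu_val vbar_val phiC phiX evC evX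
  f_monic lt_f min_f lt2_f lt_g.
rewrite /= horner_evalE (rootP g_beta) valuation0 // leNgt.
by rewrite gauss_neq0 ?irredp_neq0.
Qed.

Lemma minimal_monic_distinguished : distinguished_pair iota vbar theta 0.
Proof.
split=> [|beta|eta]; rewrite ?degree0 ?minimal_monic_degree ?subr0 //.
- exact: minimal_monic_root_nearest.
- by rewrite ltnNge degree_gt0.
Qed.

End MinimalPolynomial.

(** * Truncations and key polynomials *)

Lemma truncation_X (G : orderedQmodType) (K : fieldType)
    (w : {fraction {poly K}} -> ext G) (v : K -> ext G) (delta : G) :
    is_valuation w -> extends_val (fun c : K => tofrac c%:P) v w ->
    val_poly w 'X = Fin delta ->
  truncation w 'X =1 gauss v delta.
Proof.
move=> w_val w_ext wX f; apply: eq_bigr => i _.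
have -> : Qcoef 'X f i = (f`_i)%:P.
  rewrite /Qcoef -[X in _ %% X]subr0 -Pdiv.IdomainMonic.drop_poly_divp modp_XsubC.
  by rewrite horner_coef0 coef_drop_poly.
by rewrite /val_poly rmorphM rmorphXn valuationM // w_ext (valuationX w_val _ wX).
Qed.

Lemma psi_deg_le (G : orderedQmodType) (K : fieldType)
    (w : {fraction {poly K}} -> ext G) (Q f g : {poly K}) :
  psi w Q f -> truncation w Q g < val_poly w g -> (deg f <= deg g)%N.
Proof.
move=> [_ _]; rewrite /alpha; case: xgetP => // a -> [_ min_a] Df /min_a.
by rewrite -Df.
Qed.

(** A polynomial of degree less than deg Q is its own Q-expansion, so w and its
    truncation agree on it. *)
Lemma deg_le_alpha (G : orderedQmodType) (K : fieldType)
    (w : {fraction {poly K}} -> ext G) (Q : {poly K}) :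
  is_valuation w -> (0 < deg Q)%N -> Fin (deg Q) <= alpha w Q.
Proof.
move=> w_val Q_gt0; rewrite /alpha; case: xgetP => // a -> [[f [lt_f ->]] _].
change (deg Q <= deg f)%N; rewrite leqNgt; apply: contraL lt_f => lt_fQ.
have Q0 : Q != 0 by apply: contraTneq Q_gt0 => ->; rewrite /deg size_poly0.
have size_f : (size f < size Q)%N.
  rewrite (size_deg Q0) ltnS; apply: leq_trans lt_fQ; rewrite /deg.
  by case: (size f).
rewrite -leNgt; apply/bigmin_geP; split=> [|[i lt_i] _ /=].
  by case: (val_poly w f).
case: i lt_i => [|i] lt_i.
  by rewrite /Qcoef expr0 divp1 mulr1 modp_small.
have lt_Qi : (size f < size (Q ^+ i.+1))%N.
  apply: (leq_trans size_f); rewrite (size_deg (expf_neq0 _ Q0)) (size_deg Q0) ltnS.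
  by rewrite [in leqRHS]/deg size_exp /= leq_pmulr.
by rewrite /Qcoef divp_small // mod0p mul0r /val_poly rmorph0 valuation0 //; case: (w _).
Qed.

Theorem theorem1p21 (G : orderedQmodType) (K : fieldType)
    (Kbar : closedFieldType) (iota : {rmorphism K -> Kbar})
    (Kbar_algebraic : forall x : Kbar, algebraicOver iota x)
    (v : K -> ext G) (vbar : Kbar -> ext G)
    (w : {fraction {poly K}} -> ext G)
    (v_valuation : is_valuation v)
    (v_henselian : henselian iota v)
    (vbar_valuation : is_valuation vbar)
    (vbar_extends : extends_val iota v vbar)
    (w_valuation : is_valuation w)
    (w_extends : extends_val (fun c : K => tofrac c%:P) v w)
    (d : Order.disp_t) (Delta : orderType d)
    (I : set nat) (nu : nat -> Delta) (vartheta : nat -> set Delta)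
    (Q : Delta -> {poly K})
    (Q_complete : complete_ABKPs w Q)
    (Q_structured : structured_ABKPs w I nu vartheta Q)
    (vartheta_empty : forall j, I j -> vartheta j = set0)
    (I_neq : I <> [set 0%N]) :
  exists n : nat,
    [/\ I n, n <> 0%N & has_saturated_distinguished_chain iota vbar (Q (nu n))].
Proof.
have [I0 I1] : I 0%N /\ I 1%N.
  case: (sA_I Q_structured) => [->//|[[|N] IN]]; last by rewrite IN.
  by case: I_neq; rewrite IN; apply/seteqP; split=> -[].
have deg_X : deg ('X : {poly K}) = 1%N by rewrite /deg size_polyX.
(* If alpha(X) were deg X, then vartheta 0 would not be empty. *)
have psi_f : psi w 'X (Q (nu 1%N)).
  have := sA_alpha_gt Q_structured I0 _ I1 (or_introl erefl).
  rewrite (sA_Q0 Q_structured) deg_X; apply.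
  rewrite lt_neqAle -{2}deg_X deg_le_alpha ?deg_X // andbT.
  apply/eqP => alpha_X; have := sA_alpha_eq Q_structured I0.
  rewrite (sA_Q0 Q_structured) deg_X -alpha_X vartheta_empty // => /(_ erefl)[_ []] //.
exists 1%N; split=> //; set f := Q _ in psi_f *.
have [f_monic lt_f alpha_f] := psi_f.
have f0 := monic_neq0 f_monic.
have deg_f : (1 < deg f)%N.
  rewrite -deg_X -(sA_Q0 Q_structured).
  by apply: (sA_deg_lt Q_structured I0 I1); left.
have [delta wX] : exists delta, val_poly w 'X = Fin delta.
  by apply: valuation_fin => //; rewrite tofrac_eq0 polyX_eq0.
have truncE := truncation_X w_valuation w_extends wX; rewrite truncE in lt_f.
have min_f (g : {poly K}) : (size g < size f)%N -> w (tofrac g) <= gauss v delta g.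
  move=> lt_gf; rewrite leNgt; apply/negP; rewrite -truncE => /(psi_deg_le psi_f).
  rewrite leqNgt => /negP[]; have [->|g0] := eqVneq g 0.
    by rewrite {1}/deg size_poly0 ltnW.
  by rewrite (size_deg f0) (size_deg g0) in lt_gf.
have phiX : Fin delta <= w (tofrac ('X : {poly K})) by rewrite -/(val_poly w 'X) wX.
have [theta f_theta] : exists theta, root (map_poly iota f) theta.
  apply/closed_rootP; rewrite size_map_poly (size_deg f0).
  by apply: contraTneq deg_f => -[->].
exists 1%N, (fun i => if i is 0%N then 'X else f); split=> // [[|i] _|[|i] //].
- by have := irredp_XsubC (0 : K); rewrite subr0.
- apply: (minimal_monic_irreducible v_valuation w_valuation w_extends phiX) => //.
  by rewrite (size_deg f0) ltnS ltnW.
- exists theta, 0; split=> //; first by rewrite map_polyX rootX.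
  exact: (minimal_monic_distinguished Kbar_algebraic v_valuation vbar_valuation
            vbar_extends w_valuation w_extends phiX f_monic deg_f lt_f min_f f_theta).
Qed.
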